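(* Let $\mathcal C$ be a semi-abelian variety of universal algebras and let $A$ be an object of $\mathcal C$. Then the $A$-nullification functor $P_A$ exists, and for any object $X$ of $\mathcal C$ the coaugmentation morphism $\eta_X\colon X\to P_A(X)$ is a normal epimorphism.
   Context: A variety of universal algebras is a finitary equational class (sets equipped with finitary operations satisfying a set of identities), regarded as a category with the homomorphisms as morphisms. It is semi-abelian if it is a semi-abelian category; equivalently, its algebraic theory has a unique constant $0$ and, for some $n\ge 1$, binary terms $\alpha_1(x,y),\dots,\alpha_n(x,y)$ and an $(n+1)$-ary term $\beta$ satisfying the identities $\alpha_i(x,x)=0$ for $i\in\{1,\dots,n\}$ and $\beta(\alpha_1(x,y),\dots,\alpha_n(x,y),y)=x$. An object $Z$ of $\mathcal C$ is $A$-null if $\mathrm{Hom}(A,Z)=0$, i.e. the only morphism $A\to Z$ is the zero morphism. The $A$-nullification functor $P_A\colon\mathcal C\to\mathcal C$, with coaugmentation $\eta\colon 1_{\mathcal C}\Rightarrow P_A$, is the localization functor associated to the full replete subcategory of $A$-null objects; saying that it exists means that this subcategory is reflective in $\mathcal C$, and then $P_A$ is the composite of the reflector with the inclusion and $\eta$ is the unit of the reflection. A normal epimorphism is a cokernel of some morphism. *)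

(* Defs.v *)
From mathcomp Require Import all_boot.
From mathcomp Require Import boolp.

Set Implicit Arguments.
Unset Strict Implicit.
Unset Printing Implicit Defensive.

Record category := Category {
  obj :> Type;
  hom : obj -> obj -> Type;
  idm : forall X, hom X X;
  comp : forall X Y Z, hom Y Z -> hom X Y -> hom X Z;
  comp_idl : forall X Y (f : hom X Y), comp (idm Y) f = f;
  comp_idr : forall X Y (f : hom X Y), comp f (idm X) = f;
  comp_assoc : forall X Y Z W (h : hom Z W) (g : hom Y Z) (f : hom X Y),
    comp h (comp g f) = comp (comp h g) f }.

Arguments hom {_} X Y.
Arguments idm {_} X.
Arguments comp {_ X Y Z} g f.

Notation "g \oc f" := (comp g f) (at level 40, left associativity).

Record functor (C D : category) := Functor {
  fob :> C -> D;
  fmap : forall X Y, hom X Y -> hom (fob X) (fob Y);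
  fmap_id : forall X, fmap (idm X) = idm (fob X);
  fmap_comp : forall X Y Z (g : hom Y Z) (f : hom X Y),
    fmap (g \oc f) = fmap g \oc fmap f }.

Arguments fmap {C D} _ {X Y} _.

Definition id_functor (C : category) : functor C C :=
  @Functor C C id (fun X Y f => f) (fun X => erefl) (fun X Y Z g f => erefl).

Lemma comp_fmap_id (C D E : category) (G : functor D E) (F : functor C D) X :
  fmap G (fmap F (idm X)) = idm (G (F X)).
Proof. by rewrite !fmap_id. Qed.

Lemma comp_fmap_comp (C D E : category) (G : functor D E) (F : functor C D)
    X Y Z (g : hom Y Z) (f : hom X Y) :
  fmap G (fmap F (g \oc f)) = fmap G (fmap F g) \oc fmap G (fmap F f).
Proof. by rewrite !fmap_comp. Qed.

Definition comp_functor (C D E : category) (G : functor D E) (F : functor C D) :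
    functor C E :=
  @Functor C E (fun X => G (F X)) (fun X Y f => fmap G (fmap F f))
    (comp_fmap_id G F) (comp_fmap_comp G F).

Record nat_trans (C D : category) (F G : functor C D) := NatTrans {
  component :> forall X, hom (F X) (G X);
  naturality : forall X Y (f : hom X Y),
    component Y \oc fmap F f = fmap G f \oc component X }.

Section FullSubcategory.
Variables (C : category) (P : C -> Prop).

Record full_obj := FullObj { full_val : C; full_valP : P full_val }.

Definition full_subcategory : category :=
  @Category full_obj (fun X Y => hom (full_val X) (full_val Y))
    (fun X => idm (full_val X)) (fun X Y Z g f => g \oc f)
    (fun X Y f => comp_idl f) (fun X Y f => comp_idr f)
    (fun X Y Z W h g f => comp_assoc h g f).

Definition inclusion : functor full_subcategory C :=
  @Functor full_subcategory C full_val (fun X Y f => f)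
    (fun X => erefl) (fun X Y Z g f => erefl).

(* A left adjoint of the inclusion, presented by its unit. *)
Record reflection := Reflection {
  reflector : functor C full_subcategory;
  localization : functor C C := comp_functor inclusion reflector;
  coaug : nat_trans (id_functor C) localization;
  coaug_universal : forall (X : C) (Z : full_subcategory)
      (f : hom X (inclusion Z)),
    exists! g : hom (reflector X) Z, fmap inclusion g \oc coaug X = f }.

End FullSubcategory.

Section CategoricalNotions.
Variable C : category.
Implicit Types X Y Z : C.

Definition iso X Y (f : hom X Y) : Prop :=
  exists g : hom Y X, g \oc f = idm X /\ f \oc g = idm Y.

Definition terminal Z : Prop := forall X, exists! f : hom X Z, True.

Definition initial Z : Prop := forall X, exists! f : hom Z X, True.

Definition zero_object Z : Prop := initial Z /\ terminal Z.

Definition pointed : Prop := exists Z, zero_object Z.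

Definition zero_morphism X Y (f : hom X Y) : Prop :=
  exists Z (g : hom Z Y) (h : hom X Z), zero_object Z /\ f = g \oc h.

Definition is_pullback X Y Z (f : hom X Z) (g : hom Y Z)
    P (p : hom P X) (q : hom P Y) : Prop :=
  f \oc p = g \oc q /\
  forall T (a : hom T X) (b : hom T Y), f \oc a = g \oc b ->
    exists! u : hom T P, p \oc u = a /\ q \oc u = b.

Definition is_coproduct X Y S (i : hom X S) (j : hom Y S) : Prop :=
  forall T (a : hom X T) (b : hom Y T),
    exists! u : hom S T, u \oc i = a /\ u \oc j = b.

Definition is_coequalizer X Y Q (f g : hom X Y) (q : hom Y Q) : Prop :=
  q \oc f = q \oc g /\
  forall T (t : hom Y T), t \oc f = t \oc g -> exists! u : hom Q T, u \oc q = t.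

Definition is_cokernel X Y Q (f : hom X Y) (q : hom Y Q) : Prop :=
  zero_morphism (q \oc f) /\
  forall T (t : hom Y T), zero_morphism (t \oc f) ->
    exists! u : hom Q T, u \oc q = t.

Definition regular_epi Y Q (q : hom Y Q) : Prop :=
  exists X (f g : hom X Y), is_coequalizer f g q.

Definition normal_epi Y Q (q : hom Y Q) : Prop :=
  exists X (f : hom X Y), is_cokernel f q.

Definition finitely_complete : Prop :=
  (exists Z, terminal Z) /\
  (forall X Y Z (f : hom X Z) (g : hom Y Z),
     exists P (p : hom P X) (q : hom P Y), is_pullback f g p q).

Definition has_binary_coproducts : Prop :=
  forall X Y, exists S (i : hom X S) (j : hom Y S), is_coproduct i j.

Definition regular_category : Prop :=
  [/\ finitely_complete,
      (forall X Y (f : hom X Y) K (k1 k2 : hom K X), is_pullback f f k1 k2 ->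
         exists Q (q : hom X Q), is_coequalizer k1 k2 q)
    & (forall X Y Z (f : hom X Z) (g : hom Y Z) P (p : hom P X) (q : hom P Y),
         is_pullback f g p q -> regular_epi f -> regular_epi q)].

(* The relation induced by r1, r2 : R -> X on generalized elements of X. *)
Definition related R X (r1 r2 : hom R X) T (a b : hom T X) : Prop :=
  exists t : hom T R, r1 \oc t = a /\ r2 \oc t = b.

Definition jointly_monic R X (r1 r2 : hom R X) : Prop :=
  forall T (t t' : hom T R),
    r1 \oc t = r1 \oc t' -> r2 \oc t = r2 \oc t' -> t = t'.

Definition internal_equivalence R X (r1 r2 : hom R X) : Prop :=
  jointly_monic r1 r2 /\
  forall T,
    [/\ (forall a : hom T X, related r1 r2 a a),
        (forall a b : hom T X, related r1 r2 a b -> related r1 r2 b a)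
      & (forall a b c : hom T X, related r1 r2 a b -> related r1 r2 b c ->
           related r1 r2 a c)].

Definition Barr_exact : Prop :=
  regular_category /\
  forall R X (r1 r2 : hom R X), internal_equivalence r1 r2 ->
    exists Y (f : hom X Y), is_pullback f f r1 r2.

(* Bourn protomodularity: for each v : E -> B the change-of-base functor
   v^* : Pt(B) -> Pt(E) between categories of split epimorphisms with a chosen
   section reflects isomorphisms; w is v^* h computed on arbitrary pullbacks.
   It automatically commutes with the induced sections. *)
Definition protomodular : Prop :=
  forall (E B : C) (v : hom E B)
    X (p : hom X B) (s : hom B X) X' (p' : hom X' B) (s' : hom B X')
    (h : hom X X'),
    p \oc s = idm B -> p' \oc s' = idm B -> p' \oc h = p -> h \oc s = s' ->
  forall Q (e : hom Q E) (x : hom Q X) Q' (e' : hom Q' E) (x' : hom Q' X')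
    (w : hom Q Q'),
    is_pullback v p e x -> is_pullback v p' e' x' ->
    e' \oc w = e -> x' \oc w = h \oc x ->
    iso w -> iso h.

Definition semi_abelian : Prop :=
  [/\ pointed, has_binary_coproducts, Barr_exact & protomodular].

Definition null_object (A Z : C) : Prop := forall f : hom A Z, zero_morphism f.

Definition nullification (A : C) := reflection (null_object A).

End CategoricalNotions.

Record signature := Signature { op : Type; arity : op -> nat }.

Inductive term (S : signature) : Type :=
| Var of nat
| App (o : op S) of ('I_(arity o) -> term S).

Record variety := Variety {
  sig_of :> signature;
  identities : term sig_of -> term sig_of -> Prop }.

Fixpoint eval (S : signature) (T : Type)
    (opn : forall o : op S, ('I_(arity o) -> T) -> T)
    (v : nat -> T) (t : term S) : T :=
  match t with
  | Var n => v n
  | App o ts => opn o (fun i => eval opn v (ts i))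
  end.

(* The carrier may be empty, as usual for categories of algebras. *)
Record algebra (V : variety) := Algebra {
  carrier :> Type;
  opn : forall o : op V, ('I_(arity o) -> carrier) -> carrier;
  opnP : forall t u, identities t u ->
    forall v : nat -> carrier, eval opn v t = eval opn v u }.

Arguments opn {V} _ o _.

Section AlgebraCategory.
Variable V : variety.

Record algebra_hom (X Y : algebra V) := AlgebraHom {
  hom_fun :> X -> Y;
  hom_funP : forall (o : op V) (a : 'I_(arity o) -> X),
    hom_fun (opn X o a) = opn Y o (fun i => hom_fun (a i)) }.

Lemma algebra_hom_eq (X Y : algebra V) (f g : algebra_hom X Y) :
  f =1 g -> f = g.
Proof.
case: f g => [f fP] [g gP] /= /funext fg; case: _ / fg gP => gP.
by rewrite (Prop_irrelevance fP gP).
Qed.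

Definition algebra_id (X : algebra V) : algebra_hom X X :=
  @AlgebraHom X X id (fun o a => erefl).

Lemma algebra_comp_proof (X Y Z : algebra V)
    (g : algebra_hom Y Z) (f : algebra_hom X Y) (o : op V)
    (a : 'I_(arity o) -> X) :
  g (f (opn X o a)) = opn Z o (fun i => g (f (a i))).
Proof. by rewrite !hom_funP. Qed.

Definition algebra_comp (X Y Z : algebra V)
    (g : algebra_hom Y Z) (f : algebra_hom X Y) : algebra_hom X Z :=
  @AlgebraHom X Z (fun x => g (f x)) (algebra_comp_proof g f).

Lemma algebra_comp_idl (X Y : algebra V) (f : algebra_hom X Y) :
  algebra_comp (algebra_id Y) f = f.
Proof. exact: algebra_hom_eq. Qed.

Lemma algebra_comp_idr (X Y : algebra V) (f : algebra_hom X Y) :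
  algebra_comp f (algebra_id X) = f.
Proof. exact: algebra_hom_eq. Qed.

Lemma algebra_comp_assoc (X Y Z W : algebra V) (h : algebra_hom Z W)
    (g : algebra_hom Y Z) (f : algebra_hom X Y) :
  algebra_comp h (algebra_comp g f) = algebra_comp (algebra_comp h g) f.
Proof. exact: algebra_hom_eq. Qed.

Definition algebra_category : category :=
  @Category (algebra V) algebra_hom algebra_id algebra_comp
    algebra_comp_idl algebra_comp_idr algebra_comp_assoc.

End AlgebraCategory.

(* Main.v *)
(* The A-null algebras are closed under subobjects and products, so the
   intersection of all congruences on X with A-null quotient again has A-null
   quotient; this quotient is the reflection of X.  Hence every coaugmentation
   is surjective, and it remains to see that a surjective q is the cokernel of
   its kernel K.  If t kills K, compare the kernel pair of q with its
   subalgebra of pairs identified by t, both as points over X through the first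
   projection and the diagonal: pulled back along 0 -> X they both give K, so by
   protomodularity they coincide, i.e. q x = q y implies t x = t y. *)
From mathcomp Require Import all_boot.
From mathcomp Require Import boolp.
Require Import Defs.

Set Implicit Arguments.
Unset Strict Implicit.
Unset Printing Implicit Defensive.

(** * Reflections from universal arrows *)

Lemma reflection_of_universal_arrows (C : category) (P : C -> Prop)
    (F : C -> full_subcategory P) (eta : forall X : C, hom X (full_val (F X)))
    (etaP : forall (X Z : C) (f : hom X Z), P Z ->
      exists! g : hom (full_val (F X)) Z, g \oc eta X = f) :
  inhabited (reflection P).
Proof.
(* Choice picks a factorization of [eta Y \oc f] through [eta X]. Its uniqueness, isolated in
   [uniq], makes the choice functorial. *)
have lift X Y (f : hom X Y) : {g : hom (full_val (F X)) (full_val (F Y)) |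
    g \oc eta X = eta Y \oc f}.
  by apply: cid; have [g [? _]] := etaP _ _ (eta Y \oc f) (full_valP (F Y));
    exists g.
have uniq X Z (g g' : hom (full_val (F X)) Z) :
    P Z -> g \oc eta X = g' \oc eta X -> g = g'.
  move=> PZ E; have [k [_ kP]] := etaP _ _ (g \oc eta X) PZ.
  by rewrite -(kP g) // -(kP g').
pose fm X Y (f : hom X Y) := sval (lift X Y f).
have fmE X Y (f : hom X Y) : fm X Y f \oc eta X = eta Y \oc f.
  exact: svalP (lift X Y f).
have fm1 X : fm X X (idm X) = idm (F X).
  by apply: uniq; [exact: full_valP | rewrite fmE comp_idr comp_idl].
have fmM X Y Z (g : hom Y Z) (f : hom X Y) :
    fm X Z (g \oc f) = fm Y Z g \oc fm X Y f.
  apply: uniq; first exact: full_valP.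
  by rewrite fmE -[RHS]comp_assoc fmE !comp_assoc fmE.
pose L := @Functor C (full_subcategory P) F fm fm1 fmM.
have nat X Y (f : hom X Y) : eta Y \oc fmap (id_functor C) f =
    fmap (comp_functor (inclusion P) L) f \oc eta X by rewrite [RHS]fmE.
pose N := @NatTrans C C (id_functor C) (comp_functor (inclusion P) L) eta nat.
constructor; exists L N => X Z f.
exact: (etaP X (full_val Z) f (full_valP Z)).
Qed.

Lemma sval_inj (T : Type) (P : T -> Prop) : injective (@sval T P).
Proof. by apply: eq_sig_hprop => x p q; apply: Prop_irrelevance. Qed.

(** * Constructions on algebras: terminal algebra, products, subalgebras, equalizers *)

Section Algebras.
Variable V : variety.
Implicit Types X Y Z A : algebra V.

(** Stated for bare operations because it serves to check the identities in structures not yet known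
    to be algebras: products, subalgebras and quotients. *)
Lemma morph_eval (T U : Type) (opT : forall o : op V, ('I_(arity o) -> T) -> T)
    (opU : forall o : op V, ('I_(arity o) -> U) -> U) (f : T -> U)
    (fP : forall o a, f (opT o a) = opU o (f \o a)) v t :
  f (eval opT v t) = eval opU (f \o v) t.
Proof. by elim: t => //= o ts IH; rewrite fP; congr (opU o _); apply/funext. Qed.

Lemma trivial_identities (t u : term V) : identities t u ->
  forall v : nat -> unit,
    eval (fun _ _ => tt) v t = eval (fun _ _ => tt) v u.
Proof. by move=> _ v; case: (eval _ v t); case: (eval _ v u). Qed.

Definition trivial_algebra : algebra V := Algebra trivial_identities.

Definition to_trivial X : algebra_hom X trivial_algebra :=
  @AlgebraHom V X trivial_algebra (fun=> tt) (fun _ _ => erefl).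

Lemma to_trivial_eq X (f g : algebra_hom X trivial_algebra) : f = g.
Proof. by apply: algebra_hom_eq => x; case: (f x); case: (g x). Qed.

Section Product.
Variables X Y : algebra V.

Definition product_opn (o : op V) (a : 'I_(arity o) -> X * Y) : X * Y :=
  (opn X o (fst \o a), opn Y o (snd \o a)).

Lemma product_identities (t u : term V) : identities t u ->
  forall v : nat -> X * Y, eval product_opn v t = eval product_opn v u.
Proof.
move=> tu v; rewrite [LHS]surjective_pairing [RHS]surjective_pairing; congr pair.
  by rewrite !(@morph_eval _ _ product_opn (opn X) fst) //; apply: opnP.
by rewrite !(@morph_eval _ _ product_opn (opn Y) snd) //; apply: opnP.
Qed.

Definition product : algebra V := Algebra product_identities.

Definition product_fst : algebra_hom product X :=
  @AlgebraHom V product X fst (fun _ _ => erefl).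

Definition product_snd : algebra_hom product Y :=
  @AlgebraHom V product Y snd (fun _ _ => erefl).

Lemma pairing_proof Z (f : algebra_hom Z X) (g : algebra_hom Z Y)
    (o : op V) (a : 'I_(arity o) -> Z) :
  (f (opn Z o a), g (opn Z o a)) = opn product o (fun i => (f (a i), g (a i))).
Proof. by rewrite !hom_funP. Qed.

Definition pairing Z (f : algebra_hom Z X) (g : algebra_hom Z Y) :
  algebra_hom Z product :=
  @AlgebraHom V Z product (fun z => (f z, g z)) (pairing_proof f g).

End Product.

Section Subalgebra.
Variables (X : algebra V) (P : X -> Prop).

Definition op_closed :=
  forall (o : op V) (a : 'I_(arity o) -> X), (forall i, P (a i)) -> P (opn X o a).

Hypothesis PX : op_closed.

Definition subalgebra_opn (o : op V) (a : 'I_(arity o) -> {x | P x}) : {x | P x} :=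
  exist P (opn X o (fun i => sval (a i))) (PX (fun i => svalP (a i))).

Lemma subalgebra_identities (t u : term V) : identities t u ->
  forall v, eval subalgebra_opn v t = eval subalgebra_opn v u.
Proof.
move=> tu v; apply: sval_inj.
by rewrite !(@morph_eval _ _ subalgebra_opn (opn X) sval) //; apply: opnP.
Qed.

Definition subalgebra : algebra V := Algebra subalgebra_identities.

Definition subalgebra_incl : algebra_hom subalgebra X :=
  @AlgebraHom V subalgebra X sval (fun _ _ => erefl).

Lemma corestrict_proof Y (f : algebra_hom Y X) (fP : forall y, P (f y))
    (o : op V) (a : 'I_(arity o) -> Y) :
  exist P (f (opn Y o a)) (fP _) =
  opn subalgebra o (fun i => exist P (f (a i)) (fP (a i))).
Proof. by apply: sval_inj; rewrite /= hom_funP. Qed.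

Definition corestrict Y (f : algebra_hom Y X) (fP : forall y, P (f y)) :
  algebra_hom Y subalgebra :=
  @AlgebraHom V Y subalgebra (fun y => exist P (f y) (fP y)) (corestrict_proof fP).

End Subalgebra.

Lemma equalizer_op_closed X Y (f g : algebra_hom X Y) :
  op_closed (fun x => f x = g x).
Proof. by move=> o a fg; rewrite !hom_funP; congr (opn Y o _); apply/funext. Qed.

Arguments equalizer_op_closed {X Y} f g.

Definition equalizer X Y (f g : algebra_hom X Y) : algebra V :=
  subalgebra (equalizer_op_closed f g).

Definition equalizer_incl X Y (f g : algebra_hom X Y) :
  algebra_hom (equalizer f g) X := subalgebra_incl (equalizer_op_closed f g).

Definition equalizer_lift X Y Z (f g : algebra_hom X Y) (a : algebra_hom Z X)
    (fga : forall z, f (a z) = g (a z)) : algebra_hom Z (equalizer f g) :=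
  corestrict (equalizer_op_closed f g) fga.

Definition surjective (T U : Type) (f : T -> U) := forall u, exists t, f t = u.

Lemma surjective_factor X Y Z (q : algebra_hom X Y) (t : algebra_hom X Z) :
  surjective q -> (forall x y, q x = q y -> t x = t y) ->
  exists! u : algebra_hom Y Z, algebra_comp u q = t.
Proof.
move=> qS qt; pose s y := sval (cid (qS y)).
have sK y : q (s y) = y by rewrite /s; case: cid.
have uP (o : op V) (a : 'I_(arity o) -> Y) :
    t (s (opn Y o a)) = opn Z o (fun i => t (s (a i))).
  (* The section [s] need not be a homomorphism, but [s (opn Y o a)] and [opn X o (s \o a)] have the
     same image under [q], hence under [t]. *)
  rewrite -hom_funP; apply: qt; rewrite hom_funP sK; congr (opn Y o _).
  by apply/funext => i; rewrite sK.
exists (@AlgebraHom V Y Z (t \o s) uP); split=> [|u uE].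
  by apply: algebra_hom_eq => x; apply: qt; rewrite sK.
by apply: algebra_hom_eq => y; rewrite /= -uE /= sK.
Qed.

(** * Quotients by congruences *)

Section Quotient.
Variables (X : algebra V) (R : X -> X -> Prop).

Definition congruence :=
  [/\ forall x, R x x, forall x y, R x y -> R y x,
      forall x y z, R x y -> R y z -> R x z
    & forall (o : op V) (a b : 'I_(arity o) -> X),
        (forall i, R (a i) (b i)) -> R (opn X o a) (opn X o b)].

Hypothesis RX : congruence.

(** Classes are the predicates [R x] themselves, so that equality of classes comes from functional
    and propositional extensionality. *)
Definition quotient_carrier := {c : X -> Prop | exists x, c = R x}.

Definition class_of (x : X) : quotient_carrier :=
  exist (fun c => exists x, c = R x) (R x) (ex_intro _ x erefl).

Definition repr_of (c : quotient_carrier) : X := sval (cid (svalP c)).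

Lemma repr_ofK c : class_of (repr_of c) = c.
Proof. by apply: sval_inj; rewrite /repr_of /=; case: cid => x /= <-. Qed.

Lemma class_ofP x y : class_of x = class_of y <-> R x y.
Proof.
case: RX => Rxx Rsym Rtrans _; split=> [/(congr1 sval) /= ->|Rxy] //.
by apply/sval_inj/funext => z; apply/propext; split; apply: Rtrans => //;
  apply: Rsym.
Qed.

Definition quotient_opn (o : op V) (a : 'I_(arity o) -> quotient_carrier) :=
  class_of (opn X o (repr_of \o a)).

Lemma class_of_opn (o : op V) (a : 'I_(arity o) -> X) :
  class_of (opn X o a) = quotient_opn (class_of \o a).
Proof.
apply/class_ofP; case: RX => _ _ _; apply=> i.
by apply/class_ofP; rewrite repr_ofK.
Qed.

Lemma quotient_identities (t u : term V) : identities t u ->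
  forall v, eval quotient_opn v t = eval quotient_opn v u.
Proof.
(* Every valuation in the quotient lifts to [X] through representatives, so the identity is the
   image of one that holds in [X]. *)
move=> tu v; have -> : v = class_of \o (repr_of \o v).
  by apply/funext => n; rewrite /= repr_ofK.
by rewrite -!(morph_eval class_of_opn) (opnP tu).
Qed.

Definition quotient : algebra V := Algebra quotient_identities.

Definition quotient_proj : algebra_hom X quotient :=
  @AlgebraHom V X quotient class_of class_of_opn.

Lemma quotient_proj_surjective : surjective quotient_proj.
Proof. by move=> c; exists (repr_of c); apply: repr_ofK. Qed.

Lemma quotient_factor Z (t : algebra_hom X Z) :
  (forall x y, R x y -> t x = t y) ->
  exists! u : algebra_hom quotient Z, algebra_comp u quotient_proj = t.
Proof.
move=> Rt; apply: surjective_factor; first exact: quotient_proj_surjective.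
by move=> x y /class_ofP; apply: Rt.
Qed.

End Quotient.

Lemma kernel_congruence X Y (f : algebra_hom X Y) :
  congruence (fun x y => f x = f y).
Proof.
split=> [//|//|x y z -> //|o a b ab]; rewrite !hom_funP.
by congr (opn Y o _); apply/funext.
Qed.

(** * Zero object and zero morphisms in a pointed variety *)

Section Pointed.
Hypothesis V_pointed : pointed (algebra_category V).

(** Terminality of a zero object [Z] gives [k : 1 -> Z], and the unique [z : Z -> X] gives
    [z k : 1 -> X]. Any [f : 1 -> X] composed with [Z -> 1] must be [z], which forces [f = z k]. *)
Lemma trivial_initial : initial (trivial_algebra : algebra_category V).
Proof.
have [Z [Z_init Z_term]] := V_pointed; move=> X.
have [k _] := Z_term trivial_algebra; have [z [_ zP]] := Z_init X.
exists (algebra_comp z k); split=> // f _; apply: algebra_hom_eq => -[].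
have /= <- := congr1 (fun h : algebra_hom _ _ => h (k tt))
  (zP (algebra_comp f (to_trivial Z)) I).
by [].
Qed.

Lemma trivial_zero : zero_object (trivial_algebra : algebra_category V).
Proof.
split=> [|X]; first exact: trivial_initial.
by exists (to_trivial X); split=> // f _; apply: to_trivial_eq.
Qed.

Definition from_trivial X : algebra_hom trivial_algebra X :=
  sval (cid (trivial_initial X)).

Lemma from_trivial_eq X (f : algebra_hom trivial_algebra X) :
  f = from_trivial X.
Proof. by rewrite /from_trivial; case: cid => z [_ zP] /=; rewrite -(zP f). Qed.

(** The constant [0] of [X], obtained from initiality of the one-element algebra rather than from a
    chosen symbol of the signature. *)
Definition origin X : X := from_trivial X tt.

Lemma hom_origin X Y (f : algebra_hom X Y) : f (origin X) = origin Y.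
Proof.
by rewrite /origin -(from_trivial_eq (algebra_comp f (from_trivial X))).
Qed.

Lemma zero_morphismP X Y (f : algebra_hom X Y) :
  @zero_morphism (algebra_category V) X Y f <-> forall x, f x = origin Y.
Proof.
split=> [[Z [g [h [[Z_init _] ->]]]] x | f0].
  have [z [_ zP]] := Z_init Y.
  have -> : g = algebra_comp (from_trivial Y) (to_trivial Z).
    by rewrite -(zP g) // -(zP (algebra_comp _ _)).
  by [].
exists trivial_algebra, (from_trivial Y), (to_trivial X); split.
  exact: trivial_zero.
by apply: algebra_hom_eq => x; rewrite f0.
Qed.

(** * Null algebras and the largest null quotient *)

Definition algebra_null A Z := forall (f : algebra_hom A Z) a, f a = origin Z.

Lemma null_objectP A Z :
  @null_object (algebra_category V) A Z <-> algebra_null A Z.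
Proof. by split=> AZ f; apply/zero_morphismP; apply: AZ. Qed.

Definition null_congruence A X (R : X -> X -> Prop) :=
  exists RX : congruence R, algebra_null A (quotient RX).

Definition null_kernel A X (x y : X) :=
  forall R, @null_congruence A X R -> R x y.

Lemma null_kernel_congruence A X : congruence (@null_kernel A X).
Proof.
split=> [x R|x y xy R|x y z xy yz R|o a b ab R] RN;
  have [[R1 Rs Rt Ro] _] := RN; first exact: R1.
- by apply: Rs; apply: xy.
- by apply: (Rt _ y); [apply: xy | apply: yz].
- by apply: Ro => i; apply: ab.
Qed.

Definition null_quotient A X : algebra V := quotient (null_kernel_congruence A X).

Definition null_proj A X : algebra_hom X (null_quotient A X) :=
  quotient_proj (null_kernel_congruence A X).

Lemma null_quotient_null A X : algebra_null A (null_quotient A X).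
Proof.
move=> f a; rewrite -(hom_origin (null_proj A X)) -[LHS]repr_ofK.
apply/class_ofP; first exact: null_kernel_congruence.
(* It remains to relate a representative of [f a] to the origin under each null congruence [R]. The
   induced map [u] to [X/R] makes [u f] a map from [A] to a null algebra, so [u f] is zero. *)
move=> R [RX RXnull].
have [u [uE _]] : exists! u : algebra_hom (null_quotient A X) (quotient RX),
    algebra_comp u (null_proj A X) = quotient_proj RX.
  by apply: quotient_factor => x y xy; apply/(class_ofP RX)/(xy R); exists RX.
have uE' x : u (class_of _ x) = class_of R x.
  by rewrite -[RHS]/(quotient_proj RX x) -uE.
apply/(class_ofP RX); rewrite -!uE' repr_ofK.
rewrite -[LHS]/(algebra_comp u f a) RXnull.
by rewrite uE' -[RHS]/(quotient_proj RX (origin X)) hom_origin.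
Qed.

Lemma null_proj_universal A X Z (f : algebra_hom X Z) :
  algebra_null A Z ->
  exists! g : algebra_hom (null_quotient A X) Z,
    algebra_comp g (null_proj A X) = f.
Proof.
move=> Znull; apply: quotient_factor => x y xy.
(* The kernel congruence of [f] is one of those intersected: [X/K] embeds into the null algebra [Z]
   by [u], so every map from [A] to [X/K] is zero. *)
pose K := kernel_congruence f; apply: (xy (fun x y => f x = f y)).
exists K => g a.
have [u [uE _]] : exists! u : algebra_hom (quotient K) Z,
    algebra_comp u (quotient_proj K) = f by apply: quotient_factor.
have uE' x' : u (class_of _ x') = f x' by rewrite -[in RHS]uE.
rewrite -(hom_origin (quotient_proj K)) /= -[LHS]repr_ofK; apply/(class_ofP K).
rewrite -!uE' repr_ofK -[LHS]/(algebra_comp u g a) Znull.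
by rewrite uE' hom_origin.
Qed.

(** * Kernels, and surjections as cokernels *)

Definition kernel X Y (q : algebra_hom X Y) : algebra V :=
  equalizer q (algebra_comp (from_trivial Y) (to_trivial X)).

Definition kernel_incl X Y (q : algebra_hom X Y) : algebra_hom (kernel q) X :=
  equalizer_incl q (algebra_comp (from_trivial Y) (to_trivial X)).

Lemma kernel_inclP X Y (q : algebra_hom X Y) k : q (kernel_incl q k) = origin Y.
Proof. exact: svalP k. Qed.

(** Here [S] is a relation on [X] inside the kernel pair of [q]. Its elements with first component
    [0] are pairs [(0, k)] with [k] in the kernel, and [x] shows that all of these occur, so the
    fiber over [0] is the kernel. *)
Lemma kernel_pullback X Y S (q : algebra_hom X Y) (p1 p2 : algebra_hom S X)
    (x : algebra_hom (kernel q) S) :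
  (forall s s', p1 s = p1 s' -> p2 s = p2 s' -> s = s') ->
  (forall s, q (p1 s) = q (p2 s)) ->
  (forall k, p1 (x k) = origin X) -> (forall k, p2 (x k) = kernel_incl q k) ->
  @is_pullback (algebra_category V) _ _ _ (from_trivial X) p1 _
    (to_trivial (kernel q)) x.
Proof.
move=> p_inj qp p1x p2x; split.
  by apply: algebra_hom_eq => k; rewrite /= p1x.
move=> T a b ab.
have p1b y : p1 (b y) = origin X.
  have /= <- := congr1 (fun f : algebra_hom _ _ => f y) ab.
  by rewrite /origin; case: (a y).
have bP y : q (algebra_comp p2 b y) =
    algebra_comp (from_trivial Y) (to_trivial X) (algebra_comp p2 b y).
  by rewrite /= -qp p1b hom_origin.
exists (equalizer_lift bP); split.
  split; first exact: to_trivial_eq.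
  by apply: algebra_hom_eq => y; apply: p_inj; rewrite /= ?p1x ?p2x ?p1b.
move=> u [_ xu]; apply: algebra_hom_eq => y; apply: sval_inj => /=.
by rewrite -xu /= p2x.
Qed.

Hypothesis V_protomodular : protomodular (algebra_category V).

Lemma kernel_determines_fibers X Y Z (q : algebra_hom X Y)
    (t : algebra_hom X Z) :
  (forall x, q x = origin Y -> t x = origin Z) ->
  forall x y, q x = q y -> t x = t y.
Proof.
move=> qt x y qxy.
pose fst_ := product_fst X X; pose snd_ := product_snd X X.
(* [R] is the kernel pair of [q], and [R'] consists of its pairs that [t] also identifies. *)
pose R := equalizer (algebra_comp q fst_) (algebra_comp q snd_).
pose r : algebra_hom R _ := equalizer_incl _ _.
pose R' := equalizer (algebra_comp (algebra_comp t fst_) r)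
  (algebra_comp (algebra_comp t snd_) r).
pose h : algebra_hom R' R := equalizer_incl _ _.
have r_inj s s' : fst_ (r s) = fst_ (r s') -> snd_ (r s) = snd_ (r s') -> s = s'.
  by case: s s' => [[? ?] ?] [[? ?] ?] /= ? ?; apply: sval_inj; congr pair.
have h_inj s s' : h s = h s' -> s = s'.
  by case: s s' => [? ?] [? ?] /= ?; apply: sval_inj.
have lift W (a b : algebra_hom W X) : (forall w, q (a w) = q (b w)) ->
    (forall w, t (a w) = t (b w)) ->
    exists f : algebra_hom W R', forall w, r (h (f w)) = (a w, b w).
  move=> qab tab.
  pose f : algebra_hom W R :=
    @equalizer_lift _ _ _ (algebra_comp q fst_) (algebra_comp q snd_)
      (pairing a b) qab.
  by exists (@equalizer_lift _ _ _ (algebra_comp (algebra_comp t fst_) r)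
    (algebra_comp (algebra_comp t snd_) r) f tab).
have [d dE] := lift X (algebra_id X) (algebra_id X)
  (fun=> erefl) (fun=> erefl).
pose z : algebra_hom (kernel q) X :=
  algebra_comp (from_trivial X) (to_trivial (kernel q)).
have z0 k : z k = origin X by [].
(* The pairs [(0, w)] with [w] in the kernel lie in [R'] because [t] kills the kernel; this is where
   the hypothesis on [t] enters. *)
have [k kE] : exists f : algebra_hom (kernel q) R',
    forall w, r (h (f w)) = (z w, kernel_incl q w).
  by apply: lift => w; rewrite z0 hom_origin ?kernel_inclP ?qt ?kernel_inclP.
have d1 w : fst_ (r (h (d w))) = w by rewrite dE.
have k1 w : fst_ (r (h (k w))) = origin X by rewrite kE.
have k2 w : snd_ (r (h (k w))) = kernel_incl q w by rewrite kE.
have [g [_ hg]] : @iso (algebra_category V) _ _ h.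
  (* Change of base along [0 -> X]: both points have fiber [kernel q], and the map induced by [h]
     between the fibers is the identity. *)
  apply: (@V_protomodular _ _ (from_trivial X)
     R' (algebra_comp fst_ (algebra_comp r h)) d R (algebra_comp fst_ r) (algebra_comp h d) h _ _ _ _
     (kernel q) (to_trivial _) k (kernel q) (to_trivial _) (algebra_comp h k)
     (algebra_id _)).
  - by apply: algebra_hom_eq => w; apply: d1.
  - by apply: algebra_hom_eq => w; apply: d1.
  - exact: algebra_hom_eq.
  - by [].
  - apply: (@kernel_pullback _ _ _ _ _ (algebra_comp snd_ (algebra_comp r h))).
    + by move=> s s' E1 E2; apply/h_inj/r_inj.
    + by move=> s; apply: (svalP (h s)).
    + exact: k1.
    + exact: k2.
  - apply: (@kernel_pullback _ _ _ _ _ (algebra_comp snd_ r)).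
    + exact: r_inj.
    + by move=> s; apply: (svalP s).
    + exact: k1.
    + exact: k2.
  - exact: algebra_hom_eq.
  - exact: algebra_hom_eq.
  - by exists (algebra_id _); split; apply: algebra_hom_eq.
pose xy : R := exist _ (x, y) qxy.
(* Since [h g] is the identity, [(x, y)] is the pair underlying [g xy], an element of [R'], so [t]
   identifies its components. *)
have := svalP (g xy); rewrite -/h.
have -> : sval (g xy) = xy by rewrite -[RHS]/(algebra_id R xy) -[algebra_id R]hg.
by [].
Qed.

(** A map that kills the kernel is constant on the fibers of [q], hence factors uniquely through the
    surjection [q]. *)
Lemma surjective_normal_epi X Y (q : algebra_hom X Y) :
  surjective q -> @normal_epi (algebra_category V) X Y q.
Proof.
move=> qS; exists (kernel q), (kernel_incl q); split.
  by apply/zero_morphismP => k; apply: kernel_inclP.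
move=> T t /zero_morphismP t0; apply: surjective_factor => //.
apply: kernel_determines_fibers => x qx.
exact: (t0 (exist _ x qx)).
Qed.

End Pointed.

End Algebras.

Theorem proposition7p1 (V : variety)
    (hV : semi_abelian (algebra_category V)) (A : algebra_category V) :
  inhabited (nullification A) /\
  forall (P_A : nullification A) (X : algebra_category V),
    normal_epi (coaug P_A X).
Proof.
have [Vp _ _ Vpm] := hV.
pose F X : full_subcategory (null_object A) :=
  FullObj (proj2 (null_objectP Vp A _) (@null_quotient_null V Vp A X)).
split.
  refine (@reflection_of_universal_arrows (algebra_category V) _ F
    (null_proj Vp A) _) => X Z f.
  by move/(null_objectP Vp); apply: null_proj_universal.
(* The reflection [P] is arbitrary, so surjectivity of its unit is transported from [null_proj] by
   comparing the two universal arrows. *)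
move=> P X; apply: surjective_normal_epi => //.
pose Y : algebra V := full_val (reflector P X).
pose eta : algebra_hom X Y := coaug P X.
have Ynull : algebra_null Vp A Y.
  exact: (proj1 (null_objectP Vp A Y) (full_valP (reflector P X))).
have [u [uE _]] := null_proj_universal eta Ynull.
have [g [gE _]] := @coaug_universal _ _ P X (F X) (null_proj Vp A X).
(* Both [u g] and the identity of [Y] fix [eta], so they coincide. Thus [u] is surjective, and so is
   [eta], the composite of [u] with the quotient map. *)
have [e [_ eP]] := @coaug_universal _ _ P X (reflector P X) eta.
have ug : algebra_comp u g = algebra_id Y.
  rewrite -(eP (algebra_id Y)); last exact: algebra_hom_eq.
  by rewrite -(eP (algebra_comp u g)) // -uE -gE; apply: algebra_hom_eq.
move=> y; have [x xE] := @quotient_proj_surjective _ _ _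
  (null_kernel_congruence Vp A X) ((g : algebra_hom Y _) y).
exists x; rewrite -[LHS]/(eta x) -uE.
rewrite -[LHS]/(u (null_proj Vp A X x)) [null_proj _ _ _ x]xE.
exact: (congr1 (fun h : algebra_hom _ _ => h y) ug).
Qed.
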